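(* Let $0\le d_1\le d_2$ be integers and $R=\mathbb{C}[a,b,c,d]$. The ideal $$J=(a,b)^{d_1}\cap(c,d)^{d_2}\cap(a-c,b-d)^{d_1}\subseteq R$$ is generated by the following families of elements, where $0\le j\le d_1$: (1) $A_{i,j}=a^{d_1-j}c^{d_2-j}(a-c)^i(b-d)^{d_1-j-i}(ad-bc)^j$, $1\le i\le d_1-j$. These have bidegree $q^{d_1+d_2-j+i}t^{d_1-i}$, there are $d_1-j$ of them for fixed $j$, and among all the listed generators they are characterized by $\deg_t<d_1$. (2) $B_{i,j}=a^{d_1-j-i}b^id^{d_2-j}(b-d)^{d_1-j}(ad-bc)^j$, $1\le i\le d_1-j$. These have bidegree $q^{d_1-i}t^{d_1+d_2-j+i}$, there are $d_1-j$ of them for fixed $j$, and they are characterized by $\deg_q<d_1$. (3) $C_{i,j}=a^{d_1-j}c^id^{d_2-j-i}(b-d)^{d_1-j}(ad-bc)^j$, $1\le i\le d_2-j$. These have bidegree $q^{d_1+i}t^{d_1+d_2-j-i}$, there are $d_2-j$ of them for fixed $j$, and they are characterized by $\deg_q>d_1$, $\deg_t\ge d_1$. (4) $D_j=a^{d_1-j}d^{d_2-j}(b-d)^{d_1-j}(ad-bc)^j$, of bidegree $q^{d_1}t^{d_1+d_2-j}$; there is one such generator for each $j$, and they are characterized by $\deg_q=d_1$.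
   Context: $R$ is bigraded: $a$ and $c$ have bidegree $q$ (i.e. $\deg_q=1,\deg_t=0$), $b$ and $d$ have bidegree $t$ (i.e. $\deg_q=0,\deg_t=1$); $q^mt^n$ denotes bidegree $(\deg_q,\deg_t)=(m,n)$. *)

(* Defs.v *)
From HB Require Import structures.
From mathcomp Require Export all_boot all_order all_algebra.
From mathcomp Require Export complex.
From mathcomp Require Export mpoly.
From mathcomp Require Export boolp classical_sets functions cardinality reals.

Set Implicit Arguments.
Unset Strict Implicit.
Unset Printing Implicit Defensive.

Import GRing.Theory.

Local Open Scope classical_set_scope.
Local Open Scope ring_scope.

Section Ideals.
Variable S : comNzRingType.

(* Ideals need not be proper: (a, b)^0 is the unit ideal. *)
Definition is_ideal (I : set S) : Prop :=
  [/\ I 0,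
      forall x y, I x -> I y -> I (x + y) &
      forall r x, I x -> I (r * x)].

Definition ideal_gen (X : set S) : set S := smallest is_ideal X.

Definition ideal_mul (I J : set S) : set S :=
  ideal_gen [set p | exists x y, [/\ I x, J y & p = x * y]].

Definition ideal_exp (I : set S) (n : nat) : set S :=
  iter n (ideal_mul I) setT.

End Ideals.

Definition va {K : comNzRingType} : {mpoly K[4]} := 'X_(@Ordinal 4 0 isT).
Definition vb {K : comNzRingType} : {mpoly K[4]} := 'X_(@Ordinal 4 1 isT).
Definition vc {K : comNzRingType} : {mpoly K[4]} := 'X_(@Ordinal 4 2 isT).
Definition vd {K : comNzRingType} : {mpoly K[4]} := 'X_(@Ordinal 4 3 isT).

Definition degq (m : 'X_{1..4}) : nat :=
  (m (@Ordinal 4 0 isT) + m (@Ordinal 4 2 isT))%N.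
Definition degt (m : 'X_{1..4}) : nat :=
  (m (@Ordinal 4 1 isT) + m (@Ordinal 4 3 isT))%N.

Fact degq0 : degq 0%MM = 0%N. Proof. by rewrite /degq !mnm0E. Qed.
Fact degqD : {morph degq : m1 m2 / (m1 + m2)%MM >-> (m1 + m2)%N}.
Proof. by move=> m1 m2; rewrite /degq !mnmDE addnACA. Qed.
HB.instance Definition _ := isMeasure.Build 4 degq degq0 degqD.

Fact degt0 : degt 0%MM = 0%N. Proof. by rewrite /degt !mnm0E. Qed.
Fact degtD : {morph degt : m1 m2 / (m1 + m2)%MM >-> (m1 + m2)%N}.
Proof. by move=> m1 m2; rewrite /degt !mnmDE addnACA. Qed.
HB.instance Definition _ := isMeasure.Build 4 degt degt0 degtD.

(* [p] is excluded from being 0, so that its bidegree q^m t^n is unique. *)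
Definition has_bidegree (K : comNzRingType) (p : {mpoly K[4]}) (m n : nat) :
    Prop :=
  [/\ p != 0, p \is m.-homog for degq & p \is n.-homog for degt].

Section Generators.
Variables (K : comNzRingType) (d1 d2 : nat).

Definition idealJ : set {mpoly K[4]} :=
  ideal_exp (ideal_gen [set va; vb]) d1
  `&` ideal_exp (ideal_gen [set vc; vd]) d2
  `&` ideal_exp (ideal_gen [set va - vc; vb - vd]) d1.

(* The subtractions of exponents are never truncated when d1 <= d2 and i, j
   range over the index sets of the families below. *)
Definition genA (i j : nat) : {mpoly K[4]} :=
  va ^+ (d1 - j) * vc ^+ (d2 - j) * (va - vc) ^+ i
  * (vb - vd) ^+ (d1 - j - i) * (va * vd - vb * vc) ^+ j.

Definition genB (i j : nat) : {mpoly K[4]} :=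
  va ^+ (d1 - j - i) * vb ^+ i * vd ^+ (d2 - j)
  * (vb - vd) ^+ (d1 - j) * (va * vd - vb * vc) ^+ j.

Definition genC (i j : nat) : {mpoly K[4]} :=
  va ^+ (d1 - j) * vc ^+ i * vd ^+ (d2 - j - i)
  * (vb - vd) ^+ (d1 - j) * (va * vd - vb * vc) ^+ j.

Definition genD (j : nat) : {mpoly K[4]} :=
  va ^+ (d1 - j) * vd ^+ (d2 - j) * (vb - vd) ^+ (d1 - j)
  * (va * vd - vb * vc) ^+ j.

Definition rowA (j : nat) : set {mpoly K[4]} :=
  [set genA i j | i in [set i | (1 <= i <= d1 - j)%N]].
Definition rowB (j : nat) : set {mpoly K[4]} :=
  [set genB i j | i in [set i | (1 <= i <= d1 - j)%N]].
Definition rowC (j : nat) : set {mpoly K[4]} :=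
  [set genC i j | i in [set i | (1 <= i <= d2 - j)%N]].
Definition rowD (j : nat) : set {mpoly K[4]} := [set genD j].

Definition famA := \bigcup_(j in [set j | (j <= d1)%N]) rowA j.
Definition famB := \bigcup_(j in [set j | (j <= d1)%N]) rowB j.
Definition famC := \bigcup_(j in [set j | (j <= d1)%N]) rowC j.
Definition famD := \bigcup_(j in [set j | (j <= d1)%N]) rowD j.

Definition allgens := famA `|` famB `|` famC `|` famD.

End Generators.

Arguments idealJ {K}.
Arguments genA {K}.
Arguments genB {K}.
Arguments genC {K}.
Arguments genD {K}.
Arguments rowA {K}.
Arguments rowB {K}.
Arguments rowC {K}.
Arguments rowD {K}.
Arguments famA {K}.
Arguments famB {K}.
Arguments famC {K}.
Arguments famD {K}.
Arguments allgens {K}.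

(* Main.v *)
Require Import Defs.
From mathcomp Require Import ring zify.

(** Write [Delta = ad - bc].  On the hypersurface [Delta = 0] the two points
    [(a, b)] and [(c, d)] are proportional: it is parametrized by
    [a = s, b = s y, c = r, d = r y], and this identifies [R / (Delta)] with the
    polynomials in [s, r, y] whose monomials [s^i r^j y^k] satisfy
    [k <= i + j] ([slope_le_segre], [segre_section_mon], [segre_ker]).

    There the intersection becomes transparent.  An element of [(a, b)^d1] is
    sent to a multiple of [s^d1], one of [(c, d)^d2] to a multiple of [r^d2],
    and one of [(a - c, b - d)^d1] to a multiple of [(s - r)^d1].  These three
    powers are pairwise coprime, so an element of [J] is sent to [S h] with
    [S = r^d2 s^d1 (s - r)^d1].  Since [S] is homogeneous of degree
    [N = 2 d1 + d2] in [s, r], the monomials of [h] satisfy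
    [k <= i + j + N] ([segre_idealJ]); hence [h] is a combination of
    [y^0, ..., y^N] with coefficients in the image of [R].  The generators with
    [j = 0] are sent exactly to [S y^n] for [0 <= n <= N]: the families
    [A, C, D, B] fill, in this order, the exponents [n < d1],
    [d1 <= n < d1 + d2], [n = d1 + d2] and [n > d1 + d2] ([segre_gens]).

    So every [f] in [J(d1, d2)] is a combination of generators plus some
    [Delta g], where [Delta g] is still in [J(d1, d2)].  As [Delta] has order
    exactly one along each of the three ideals, and orders add up, [g] lies in
    [J(d1 - 1, d2 - 1)] ([idealJ_colon]).  Multiplication by [Delta] turns the
    generators for [(d1 - 1, d2 - 1)] and index [j] into those for [(d1, d2)]
    and index [j + 1], and induction on [d1] concludes; for [d1 = 0] the ideal
    is [(c, d)^d2], whose monomial generators are the families [C] and [D].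

    That orders add up is proved with Rees morphisms [R -> R[X]], which detect
    membership in a power of an ideal by divisibility by a power of [X]
    ([ideal_exp_colon]).  The claims on cardinals and degrees follow from the
    bidegrees of the generators. *)

Set Implicit Arguments.
Unset Strict Implicit.
Unset Printing Implicit Defensive.

Import GRing.Theory.

Local Open Scope classical_set_scope.
Local Open Scope card_scope.
Local Open Scope ring_scope.

(** * Powers of ideals *)

Section IdealTheory.
Variable S : comNzRingType.
Implicit Types (I : set S) (X : set S).

Lemma ideal_gen_is_ideal X : is_ideal (ideal_gen X).
Proof.
split=> [I [[I0 _ _] _] //|x y Ix Iy I II|r x Ix I II].
  by have [[_ ID _] _] := II; apply: ID; [apply: Ix|apply: Iy].
by have [[_ _ IM] _] := II; apply: IM; apply: Ix.
Qed.

Lemma sub_ideal_gen X x : X x -> ideal_gen X x.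
Proof. by move=> Xx I [_]; apply. Qed.

Lemma ideal_gen_ind X (I : set S) :
  is_ideal I -> (forall x, X x -> I x) -> forall x, ideal_gen X x -> I x.
Proof. by move=> II XI x; apply. Qed.

Lemma ideal_exp_is_ideal I n : is_ideal (ideal_exp I n).
Proof. by case: n => [|n]; [split|apply: ideal_gen_is_ideal]. Qed.

Lemma ideal_expS I n x y : I x -> ideal_exp I n y -> ideal_exp I n.+1 (x * y).
Proof. by move=> Ix Iy; apply: sub_ideal_gen; exists x, y. Qed.

Lemma is_ideal_colon I w : is_ideal I -> is_ideal [set t | I (t * w)].
Proof.
move=> [I0 ID IM]; split=> [|t t' It It'|r t It] /=; first by rewrite mul0r.
- by rewrite mulrDl; apply: ID.
- by rewrite -mulrA; apply: IM.
Qed.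

Lemma ideal_expD I m n x y :
  ideal_exp I m x -> ideal_exp I n y -> ideal_exp I (m + n) (x * y).
Proof.
move=> + Iy; elim: m x => [|m IHm] x.
  by move=> _; case: (ideal_exp_is_ideal I n) => _ _; apply.
apply: (ideal_gen_ind (is_ideal_colon y (ideal_exp_is_ideal I (m.+1 + n)))).
move=> _ [u [v [Iu Iv ->]]].
by rewrite /= -mulrA; exact: (ideal_expS Iu (IHm _ Iv)).
Qed.

Lemma ideal_expX I n x : I x -> ideal_exp I n (x ^+ n).
Proof.
by move=> Ix; elim: n => [//|n IHn]; rewrite exprS; apply: ideal_expS.
Qed.

Lemma ideal_exp_le I m n x :
  (m <= n)%N -> ideal_exp I n x -> ideal_exp I m x.
Proof.
move=> le_mn; rewrite -(subnK le_mn); elim: (n - m)%N => [//|k IHk].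
rewrite addSn => Ix; apply: IHk; have II := ideal_exp_is_ideal I (k + m).
apply: (ideal_gen_ind II) Ix => _ [u [v [_ Iv ->]]].
by case: II => _ _; apply.
Qed.

Lemma ideal_exp_gen_pow X x n : X x -> ideal_exp (ideal_gen X) n (x ^+ n).
Proof. by move=> Xx; apply: ideal_expX; apply: sub_ideal_gen. Qed.

Lemma ideal_exp_pair (x y : S) i n : (i <= n)%N ->
  ideal_exp (ideal_gen [set x; y]) n (x ^+ i * y ^+ (n - i)).
Proof.
move=> le_in; rewrite -[n in ideal_exp _ n](subnKC le_in).
by apply: ideal_expD; apply: ideal_expX; apply: sub_ideal_gen; [left|right].
Qed.

(** Membership in a power of an ideal is tested by morphisms that send the ideal
    into a principal one: it becomes divisibility by a power of one element. *)
Lemma dvd_ideal_exp (T : comNzRingType) (f : {rmorphism S -> T}) X p n x :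
    (forall x, X x -> exists u, f x = p * u) ->
  ideal_exp (ideal_gen X) n x -> exists u, f x = p ^+ n * u.
Proof.
have divP q : is_ideal [set x | exists u, f x = q * u].
  split=> [|y z [u fy] [v fz]|r y [u fy]] /=.
  - by exists 0; rewrite rmorph0 mulr0.
  - by exists (u + v); rewrite rmorphD fy fz mulrDr.
  - by exists (f r * u); rewrite rmorphM fy mulrCA.
move=> Xp; elim: n x => [|n IHn] x; first by exists (f x); rewrite mul1r.
apply: (ideal_gen_ind (divP _)) => _ [y [z [Iy Iz ->]]].
have [u fy] := ideal_gen_ind (divP p) Xp Iy.
have [v fz] := IHn _ Iz.
by exists (u * v); rewrite rmorphM fy fz exprS mulrACA.
Qed.

(** Together with [ideal_exp_pair], this identifies the power of a two-generated
    ideal with the ideal of the monomials in the two generators. *)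
Lemma ideal_exp_pair_ind (x y : S) n (I : set S) :
    is_ideal I -> (forall i, (i <= n)%N -> I (x ^+ i * y ^+ (n - i))) ->
  forall z, ideal_exp (ideal_gen [set x; y]) n z -> I z.
Proof.
elim: n I => [|n IHn] I II Ixy z.
  move=> _; have [_ _ IM] := II; rewrite -[z]mulr1; apply: IM.
  by have := Ixy 0%N isT; rewrite mulr1.
have [I0 ID IM] := II.
apply: (ideal_gen_ind II) => _ [u [v [Iu Iv ->]]].
apply: (ideal_gen_ind (is_ideal_colon v II)) Iu => _ [->|->] /=.
  rewrite mulrC; apply: (IHn _ (is_ideal_colon x II)) Iv => i le_in /=.
  by rewrite mulrC mulrA -exprS -subSS; apply: Ixy.
rewrite mulrC; apply: (IHn _ (is_ideal_colon y II)) Iv => i le_in /=.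
by rewrite -mulrA -exprSr -subSn //; apply: Ixy; apply: leqW.
Qed.
End IdealTheory.

(** * Rees morphisms and division by the minor *)

Lemma mpoly_ring_ind n (K : nzRingType) (P : {mpoly K[n]} -> Prop) :
    (forall c, P c%:MP) -> (forall i, P 'X_i) ->
    (forall p q, P p -> P q -> P (p + q)) ->
    (forall p q, P p -> P q -> P (p * q)) ->
  forall p, P p.
Proof.
move=> PC PX PD PM; elim/mpolyind => [|c m p _ _ IHp]; first exact: PC 0.
apply: (PD) IHp; rewrite -mul_mpolyC; apply: (PM); first exact: PC.
rewrite mpolyXE_id; apply: big_ind => [||i _]; [exact: PC 1|exact: PM|].
by elim: (m i) => [|k IHk]; [exact: PC 1|rewrite exprS; apply: (PM)].
Qed.

Section Rees.
Variables (K : idomainType) (n : nat).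
Notation R := {mpoly K[n]}.

(** If [u i + w i = 'X_i] with [w i] in an ideal [I], then [rho] takes its
    values in the Rees algebra, the polynomials whose coefficient at ['X^k] is
    in [I ^ k], and it recovers its argument at ['X = 1].
    It is used through these equations, so that its construction by
    substitution is never unfolded. *)
Definition is_rees (u w : 'I_n -> R) (rho : R -> {poly R}) : Prop :=
  (forall c, rho c%:MP = (c%:MP)%:P) /\
  (forall i, rho 'X_i = (u i)%:P + (w i)%:P * 'X).

Lemma is_rees_exists u w :
  exists rho : {rmorphism R -> {poly R}}, is_rees u w rho.
Proof.
exists (mmap (polyC \o @mpolyC n K) (fun i => (u i)%:P + (w i)%:P * 'X)).
by split=> [c|i]; [exact: mmapC|by rewrite [LHS]mmapX mmap1U].
Qed.

Section ReesMap.
Variables (u w : 'I_n -> R) (rho : {rmorphism R -> {poly R}}).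
Hypotheses (rhoP : is_rees u w rho) (uwE : forall i, u i + w i = 'X_i).
Implicit Types (X : set R).

Lemma horner_rees f : (rho f).[1] = f.
Proof.
elim/mpoly_ring_ind: f => [c|i|p q IHp IHq|p q IHp IHq].
- by rewrite rhoP.1 hornerC.
- by rewrite rhoP.2 hornerD hornerCM hornerX !hornerC mulr1 uwE.
- by rewrite -[in RHS]IHp -[in RHS]IHq rmorphD hornerD.
- by rewrite -[in RHS]IHp -[in RHS]IHq rmorphM hornerM.
Qed.

(** The Rees algebra is a ring that contains the images of the variables. *)
Lemma coef_rees X f k : (forall i, ideal_gen X (w i)) ->
  ideal_exp (ideal_gen X) k (rho f)`_k.
Proof.
move=> Xw.
have I0 j : ideal_exp (ideal_gen X) j 0.
  by have [] := ideal_exp_is_ideal (ideal_gen X) j.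
have ID j x y := let: And3 _ D _ := ideal_exp_is_ideal (ideal_gen X) j in D x y.
have IC c j : ideal_exp (ideal_gen X) j (c%:P)`_j.
  by rewrite coefC; case: j => [|j] //=; exact: (I0 j.+1).
elim/mpoly_ring_ind: f k => [c|i|p q IHp IHq|p q IHp IHq] k.
- by rewrite rhoP.1; apply: IC.
- rewrite rhoP.2 coefD coefCM coefX; apply: (ID); first exact: IC.
  case: k => [//|[|k]]; rewrite ?mulr0; last exact: I0.
  by rewrite mulr1 -[w i]expr1; apply: ideal_expX.
- by rewrite rmorphD coefD; apply: (ID).
- rewrite rmorphM coefM; apply: big_ind => [//||j _]; first exact: ID.
  by have := ideal_expD (IHp j) (IHq (k - j)%N); rewrite subnKC // -ltnS.
Qed.

(** An element [D] that is a single nonzero term of degree one in the Rees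
    algebra has order exactly one along the ideal, and [R[X]] is a domain: if
    ['X^(m+1)] divides ['X * c * rho g], then ['X^m] divides [rho g]. The
    coefficients of [rho g], whose sum is [g], then all lie in the [m]-th
    power. *)
Lemma ideal_exp_colon X D c m g :
    (forall i, ideal_gen X (w i)) ->
    (forall x, X x -> rho x = 'X * x%:P) ->
    rho D = 'X * c%:P -> c != 0 ->
  ideal_exp (ideal_gen X) m.+1 (D * g) -> ideal_exp (ideal_gen X) m g.
Proof.
move=> Xw wX wD c0 IDg.
have [|v] := @dvd_ideal_exp _ _ rho X 'X m.+1 _ _ IDg.
  by move=> x /wX wx; exists x%:P; exact: wx.
rewrite rmorphM wD exprS -!mulrA => /(mulfI (negbT (polyX_eq0 _))) wg.
rewrite -(horner_rees g) horner_coef.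
have [I0 ID IM] := ideal_exp_is_ideal (ideal_gen X) m.
apply: big_ind => // k _; rewrite expr1n mulr1.
have [le_mk|lt_km] := leqP m k; first exact/(ideal_exp_le le_mk)/coef_rees.
suff -> : (rho g)`_k = 0 by [].
apply: (mulfI c0); rewrite mulr0 -coefCM wg.
by rewrite mulrC coefMXn lt_km.
Qed.
End ReesMap.
End Rees.

Section FourVars.
Variable K : idomainType.
Notation R := {mpoly K[4]}.
Definition vdet : R := va * vd - vb * vc.

Lemma vdet_neq0 : vdet != 0.
Proof.
(* At (a, b, c, d) = (1, 0, 0, 1) the minor takes the value 1. *)
pose x (i : 'I_4) : K := ((i == 0 :> nat) || (i == 3 :> nat))%:R.
apply/eqP => /(congr1 (meval x)).
rewrite rmorphB !rmorphM /= !mevalXU !rmorph0 /= !(mulr1, mulr0) subr0.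
exact/eqP/oner_neq0.
Qed.

(** Reduction of [ideal_exp_colon] to four variables: only the images of the
    variables under the Rees morphism are left to the three ideals below. *)
Lemma vdet_colon X (ua ub uc ud wa wb wc wd : R) m g :
    [/\ ua + wa = va, ub + wb = vb, uc + wc = vc & ud + wd = vd] ->
    [/\ ideal_gen X wa, ideal_gen X wb, ideal_gen X wc & ideal_gen X wd] ->
    (forall rho : {rmorphism R -> {poly R}},
       rho va = ua%:P + wa%:P * 'X -> rho vb = ub%:P + wb%:P * 'X ->
       rho vc = uc%:P + wc%:P * 'X -> rho vd = ud%:P + wd%:P * 'X ->
       (forall x, X x -> rho x = 'X * x%:P) /\ rho vdet = 'X * vdet%:P) ->
  ideal_exp (ideal_gen X) m.+1 (vdet * g) -> ideal_exp (ideal_gen X) m g.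
Proof.
move=> [Ea Eb Ec Ed] [Xa Xb Xc Xd] XP IDg.
have [rho rhoP] := @is_rees_exists K 4 (fun i => [:: ua; ub; uc; ud]`_i)
                                       (fun i => [:: wa; wb; wc; wd]`_i).
have [||||rhoX rhoD] := XP rho.
- exact: rhoP.2 (@Ordinal 4 0 isT).
- exact: rhoP.2 (@Ordinal 4 1 isT).
- exact: rhoP.2 (@Ordinal 4 2 isT).
- exact: rhoP.2 (@Ordinal 4 3 isT).
apply: (ideal_exp_colon rhoP _ _ rhoX rhoD vdet_neq0 IDg).
- by case=> [[|[|[|[|]]]] //= i]; rewrite (bool_irrelevance i isT).
- by case=> [[|[|[|[|]]]]].
Qed.

Lemma vdet_colon_ab m g :
  ideal_exp (ideal_gen [set va; vb]) m.+1 (vdet * g) ->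
  ideal_exp (ideal_gen [set va; vb : R]) m g.
Proof.
have [I0 _ _] := ideal_gen_is_ideal [set va; vb : R].
apply: (@vdet_colon _ 0 0 vc vd va vb 0 0).
- by rewrite ?addr0 ?add0r ?subrKC.
- by split=> //; apply: sub_ideal_gen; [left|right].
move=> rho ra rb rc rd; split=> [_ [->|->]|];
  rewrite ?/vdet ?(rmorphB rho) ?(rmorphM rho) ?ra ?rb ?rc ?rd
          !(polyC0, polyCB, polyCM);
  move: (@va K)%:P (@vb K)%:P (@vc K)%:P (@vd K)%:P => A B C D; ring.
Qed.

Lemma vdet_colon_cd m g :
  ideal_exp (ideal_gen [set vc; vd]) m.+1 (vdet * g) ->
  ideal_exp (ideal_gen [set vc; vd : R]) m g.
Proof.
have [I0 _ _] := ideal_gen_is_ideal [set vc; vd : R].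
apply: (@vdet_colon _ va vb 0 0 0 0 vc vd).
- by rewrite ?addr0 ?add0r ?subrKC.
- by split=> //; apply: sub_ideal_gen; [left|right].
move=> rho ra rb rc rd; split=> [_ [->|->]|];
  rewrite ?/vdet ?(rmorphB rho) ?(rmorphM rho) ?ra ?rb ?rc ?rd
          !(polyC0, polyCB, polyCM);
  move: (@va K)%:P (@vb K)%:P (@vc K)%:P (@vd K)%:P => A B C D; ring.
Qed.

(** The Rees morphism replaces [(a, b)] by [(c, d) + X (a - c, b - d)] and fixes
    [(c, d)]: this multiplies [(a - c, b - d)] by [X], and the minor as well,
    since the minor of [(c, d)] with itself vanishes. *)
Lemma vdet_colon_diff m g :
  ideal_exp (ideal_gen [set va - vc; vb - vd]) m.+1 (vdet * g) ->
  ideal_exp (ideal_gen [set va - vc; vb - vd : R]) m g.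
Proof.
have [I0 _ _] := ideal_gen_is_ideal [set va - vc; vb - vd : R].
apply: (@vdet_colon _ vc vd vc vd (va - vc) (vb - vd) 0 0).
- by rewrite ?addr0 ?add0r ?subrKC.
- by split=> //; apply: sub_ideal_gen; [left|right].
move=> rho ra rb rc rd; split=> [_ [->|->]|];
  rewrite ?/vdet ?(rmorphB rho) ?(rmorphM rho) ?ra ?rb ?rc ?rd
          !(polyC0, polyCB, polyCM);
  move: (@va K)%:P (@vb K)%:P (@vc K)%:P (@vd K)%:P => A B C D; ring.
Qed.

End FourVars.

(** * Coefficientwise sums and linear factors of polynomials *)

Section CoefSum.
Variables (A : nzRingType) (V : zmodType) (F : nat -> A -> V).
Hypothesis FD : forall i, {morph F i : x y / x + y}.
(** The additive extension to all polynomials of a map given on monomials. *)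
Definition coef_sum (p : {poly A}) : V := \sum_(i < size p) F i p`_i.

Let F0 i : F i 0 = 0.
Proof. by apply: (addrI (F i 0)); rewrite -FD !addr0. Qed.

Lemma coef_sum_widen n (p : {poly A}) : (size p <= n)%N ->
  coef_sum p = \sum_(i < n) F i p`_i.
Proof.
move=> le_pn; rewrite /coef_sum (big_ord_widen n (fun i => F i p`_i)) //.
rewrite big_mkcond; apply: eq_bigr => i _.
by case: ltnP => // le_pi; rewrite nth_default.
Qed.

Lemma coef_sumD : {morph coef_sum : p q / p + q}.
Proof.
move=> p q; pose n := maxn (size p) (size q).
rewrite !(@coef_sum_widen n) ?leq_maxl ?leq_maxr ?size_polyD //.
by rewrite -big_split; apply: eq_bigr => i _; rewrite coefD FD.
Qed.

Lemma coef_sum_monom c n : coef_sum (c%:P * 'X^n) = F n c.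
Proof.
rewrite (@coef_sum_widen n.+1); last first.
  by rewrite mul_polyC (leq_trans (size_scale_leq _ _)) ?size_polyXn.
rewrite big_ord_recr big1 /= => [|i _].
  by rewrite add0r coefCM coefXn eqxx mulr1.
by rewrite coefCM coefXn ltn_eqF // mulr0.
Qed.
End CoefSum.

Section LinearFactor.
Variable A : idomainType.
(** Powers of a monic linear factor are coprime to any polynomial that does not
    vanish at its root. *)
Lemma dvd_pow_linear (c : A) m (q g u : {poly A}) : q.[c] != 0 ->
  q * g = ('X - c%:P) ^+ m * u -> exists v, g = ('X - c%:P) ^+ m * v.
Proof.
move=> qc; elim: m g => [|m IHm] g E; first by exists g; rewrite mul1r.
have /factor_theorem[g' gE] : root g c.
  have := congr1 (horner^~ c) E; rewrite exprS -mulrA !hornerM hornerXsubC.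
  by rewrite subrr mul0r => /eqP; rewrite mulf_eq0 (negbTE qc).
have [|v vE] := IHm g'.
  apply: (mulfI (negbT (polyXsubC_eq0 c))).
  by rewrite mulrCA [_ * g']mulrC -gE E exprS mulrA.
by exists v; rewrite gE vE exprSr mulrAC.
Qed.
End LinearFactor.

(** * The Segre morphism *)

Section Segre.
Variable K : idomainType.
Notation R := {mpoly K[4]}.
Notation T := {poly {poly {poly K}}}.
Implicit Types (g h : T) (f : R).

(** The parameters [s], [r], [y] are, in this order, the outer, middle and inner
    variables of [T]: [s] and [s - r] are then monic linear polynomials in the
    outer variable, and the [y]-degree is the size of an inner coefficient. *)
Definition vs : T := 'X.
Definition vr : T := 'X%:P.
Definition vy : T := 'X%:P%:P.
Definition vk (c : K) : T := c%:P%:P%:P.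

Definition smon c i j k : T := vk c * vs ^+ i * vr ^+ j * vy ^+ k.

Lemma smonE c i j k :
  smon c i j k = (((c%:P * 'X^k)%:P * 'X^j)%:P * 'X^i).
Proof.
rewrite /smon /vk /vs /vr /vy !(polyCM, rmorphXn) /=.
by rewrite -!mulrA; congr (_ * _); rewrite mulrC -!mulrA mulrCA.
Qed.

Lemma coef_smon c i j k l m :
  (smon c i j k)`_l`_m = (c%:P * 'X^k) *+ ((l == i) && (m == j)).
Proof.
rewrite smonE coefCM coefXn; case: eqP => _ /=; last by rewrite mulr0 coef0.
rewrite mulr1 coefCM coefXn; case: eqP => _ /=; last by rewrite mulr0.
by rewrite mulr1.
Qed.

Lemma smon_expand h : h =
  \sum_(i < size h) \sum_(j < size (h`_i)) \sum_(k < size (h`_i`_j))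
    smon (h`_i`_j`_k) i j k.
Proof.
rewrite -[LHS]coefK poly_def; apply: eq_bigr => i _.
rewrite -mul_polyC -[X in X%:P * _ = _]coefK poly_def rmorph_sum mulr_suml.
apply: eq_bigr => j _ /=.
rewrite -mul_polyC -[X in (X%:P * _)%:P * _ = _]coefK poly_def.
rewrite rmorph_sum mulr_suml rmorph_sum mulr_suml; apply: eq_bigr => k _ /=.
by rewrite -mul_polyC smonE.
Qed.

(** Every monomial [s^i r^j y^k] of [h] satisfies [k <= i + j + e]. For [e = 0]
    these are the polynomials in [s, s y, r, r y], that is, the coordinate ring
    of the hypersurface [ad = bc]. *)
Definition slope_le e h : Prop :=
  forall i j, (size (h`_i`_j)%R <= (i + j + e).+1)%N.

Lemma slope_le_ind e (P : T -> Prop) :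
    P 0 -> (forall g h, P g -> P h -> P (g + h)) ->
    (forall c i j k, (k <= i + j + e)%N -> P (smon c i j k)) ->
  forall h, slope_le e h -> P h.
Proof.
move=> P0 PD PM h he; rewrite [h]smon_expand.
apply: big_ind => // i _; apply: big_ind => // j _; apply: big_ind => // k _.
by apply: PM; rewrite -ltnS; apply: leq_trans (he i j).
Qed.

Lemma slope_le_vr e h : slope_le e (vr * h) -> slope_le e.+1 h.
Proof.
move=> He i j; have := He i j.+1.
by rewrite /vr coefCM coefXM /= addnS -addSn addnS addSn.
Qed.

Lemma slope_le_vs e h : slope_le e (vs * h) -> slope_le e.+1 h.
Proof.
by move=> He i j; have := He i.+1 j; rewrite /vs coefXM /= addnS !addSn.
Qed.

(** The coefficient of [(s - r) h] at [s^(i+1) r^(j+1)] is the difference of two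
    coefficients of [h], whose [s]-exponents are [i] and [i + 1]: the bound
    propagates from the smaller [s]-exponent to the larger one. *)
Lemma slope_le_sub e h : slope_le e ((vs - vr) * h) -> slope_le e.+1 h.
Proof.
move=> He; elim=> [|i IHi] j.
  have := He 0%N j.+1; rewrite mulrBl !coefB /vs /vr coefXM coefCM coefXM /=.
  by rewrite coef0 sub0r size_polyN !add0n addSnnS.
have := He i.+1 j.+1; rewrite mulrBl !coefB /vs /vr coefXM coefCM coefXM /=.
set p := h`_i`_j.+1; set q := h`_i.+1`_j => le_pq.
have -> : q = p - (p - q) by rewrite subKr.
rewrite (leq_trans (size_polyD _ _)) // size_polyN geq_max.
have := IHi j.+1; rewrite -/p; move: (size p) (size _) le_pq => a b; lia.
Qed.

(** The product of the three powers that divide the images of [J]. *)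
Definition common_factor d1 d2 : T := vr ^+ d2 * vs ^+ d1 * (vs - vr) ^+ d1.

Lemma slope_le_common_factor d1 d2 h :
  slope_le 0 (common_factor d1 d2 * h) -> slope_le (d1 + d1 + d2) h.
Proof.
have slope_leX p : (forall e g, slope_le e (p * g) -> slope_le e.+1 g) ->
    forall n e g, slope_le e (p ^+ n * g) -> slope_le (n + e) g.
  move=> Hp; elim=> [|n IHn] e g; first by rewrite mul1r.
  by rewrite exprSr -mulrA addSn => /IHn /Hp.
rewrite /common_factor -!mulrA => /(slope_leX _ slope_le_vr).
move=> /(slope_leX _ slope_le_vs) /(slope_leX _ slope_le_sub).
by rewrite addn0 addnA.
Qed.

Lemma common_factor_dvd d1 d2 h u1 u2 u3 :
    h = vs ^+ d1 * u1 -> h = vr ^+ d2 * u2 -> h = (vs - vr) ^+ d1 * u3 ->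
  exists u, h = common_factor d1 d2 * u.
Proof.
move=> h1 h2 h3.
have X0 n : 'X^n != 0 :> {poly {poly K}} by rewrite monic_neq0 ?monicXn.
(* [s = 0] is not a root of the constant [r^d2]. *)
have [||v u2E] := @dvd_pow_linear _ 0 d1 (vr ^+ d2) u2 u1.
- by rewrite /vr -rmorphXn /= hornerC.
- by rewrite polyC0 subr0 -h2 h1.
rewrite polyC0 subr0 in u2E.
(* [s = r] is not a root of [r^d2 s^d1]. *)
have [||w vE] := @dvd_pow_linear _ 'X d1 (vr ^+ d2 * vs ^+ d1) v u3.
- rewrite /vr /vs -rmorphXn /= hornerM hornerC hornerXn mulf_neq0 //.
- by rewrite -/vr -/vs -h3 h2 u2E -mulrA.
by exists w; rewrite h2 u2E vE /common_factor !mulrA.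
Qed.

(** The parametrization of [ad = bc] by [(a, b) = s (1, y)] and
    [(c, d) = r (1, y)]. *)
Definition is_segre (phi : R -> T) : Prop :=
  [/\ forall c, phi c%:MP = vk c, phi va = vs, phi vb = vs * vy,
      phi vc = vr & phi vd = vr * vy].

Lemma is_segre_exists : exists phi : {rmorphism R -> T}, is_segre phi.
Proof.
exists (mmap (polyC \o polyC \o polyC)
  (fun i => [:: vs; vs * vy; vr; vr * vy]`_i)).
by split=> [c||||]; [exact: mmapC| | | |]; rewrite [LHS]mmapX mmap1U.
Qed.

Lemma mpolyX4E (m : 'X_{1..4}) : 'X_[m] =
  va ^+ m (@Ordinal 4 0 isT) * vb ^+ m (@Ordinal 4 1 isT)
  * vc ^+ m (@Ordinal 4 2 isT) * vd ^+ m (@Ordinal 4 3 isT) :> R.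
Proof.
rewrite mpolyXE_id !big_ord_recl big_ord0 mulr1 !mulrA.
by congr (_ ^+ m _ * _ ^+ m _ * _ ^+ m _ * _ ^+ m _);
  rewrite /va /vb /vc /vd; try congr 'X__; try exact: val_inj.
Qed.

(** The monomial without factor [ad] that maps to [s^i r^j y^k]; such a monomial
    exists when [k <= i + j], and subtractions are truncated otherwise. *)
Definition section_mon i j k : R :=
  if (k <= i)%N then va ^+ (i - k) * vb ^+ k * vc ^+ j
  else vb ^+ i * vc ^+ (j - (k - i)) * vd ^+ (k - i).

(** Rewriting [ad] into [bc] brings any monomial to one without factor [ad],
    by using up whichever of [a] and [d] has the smaller exponent. *)
Lemma section_mon_congr i j k l : exists f,
  section_mon (i + j) (k + l) (j + l) =
  va ^+ i * vb ^+ j * vc ^+ k * vd ^+ l + vdet K * f.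
Proof.
have XX n : exists f, (vb * vc) ^+ n = (va * vd) ^+ n + vdet K * f.
  exists (- (\sum_(i < n) (va * vd) ^+ (n.-1 - i) * (vb * vc) ^+ i)).
  by rewrite mulrN -subrXX opprB addrC subrK.
rewrite /section_mon; case: leqP => [le_li|lt_il].
  have {}le_li : (l <= i)%N by lia.
  have [f E] := XX l; exists (va ^+ (i - l) * vb ^+ j * vc ^+ k * f).
  have -> : (i + j - (j + l) = i - l)%N by lia.
  move: (i - l)%N (subnK le_li) => n <-.
  transitivity (va ^+ n * vb ^+ j * vc ^+ k * (vb * vc) ^+ l : R).
    by rewrite !exprD !exprMn; ring.
  by rewrite E !exprD !exprMn; ring.
have {}lt_il : (i <= l)%N by lia.
have [f E] := XX i; exists (vb ^+ j * vc ^+ k * vd ^+ (l - i) * f).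
have -> : (j + l - (i + j) = l - i)%N by lia.
have -> : (k + l - (l - i) = k + i)%N by lia.
move: (l - i)%N (subnK lt_il) => n <-.
transitivity (vb ^+ j * vc ^+ k * vd ^+ n * (vb * vc) ^+ i : R).
  by rewrite !exprD !exprMn; ring.
by rewrite E !exprD !exprMn; ring.
Qed.

(** Additive, so that its effect on the image of [R] can be checked on
    monomials: up to a multiple of the minor it inverts the Segre morphism
    there, which determines the kernel. *)
Definition segre_section : T -> R :=
  coef_sum (fun i => coef_sum (fun j => coef_sum (fun k c =>
    c%:MP * section_mon i j k))).

Lemma segre_sectionD : {morph segre_section : g h / g + h}.
Proof.
do 3 apply: coef_sumD => ?.
by move=> c c'; rewrite mpolyCD mulrDl.
Qed.

Lemma segre_section_smon c i j k :
  segre_section (smon c i j k) = c%:MP * section_mon i j k.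
Proof.
have D3 i' j' : {morph (fun p => coef_sum (fun k c =>
    c%:MP * section_mon i' j' k) p) : p q / p + q >-> p + q : R}.
  by apply: coef_sumD => k' c1 c2; rewrite mpolyCD mulrDl.
have D2 i' : {morph (fun p => coef_sum (fun j p => coef_sum (fun k c =>
    c%:MP * section_mon i' j k) p) p) : p q / p + q >-> p + q : R}.
  by apply: coef_sumD => j'; apply: D3.
rewrite smonE /segre_section (coef_sum_monom D2) (coef_sum_monom (D3 i)).
by rewrite coef_sum_monom // => k' c1 c2; rewrite mpolyCD mulrDl.
Qed.

Section SegreMap.
Variable phi : {rmorphism R -> T}.
Hypothesis phiP : is_segre phi.

Lemma segre_mpolyX (c : K) (m : 'X_{1..4}) : phi (c *: 'X_[m]) =
  smon c (m (@Ordinal 4 0 isT) + m (@Ordinal 4 1 isT))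
         (m (@Ordinal 4 2 isT) + m (@Ordinal 4 3 isT))
         (m (@Ordinal 4 1 isT) + m (@Ordinal 4 3 isT)).
Proof.
have [phiC pa pb pc pd] := phiP.
rewrite -mul_mpolyC mpolyX4E !(rmorphM phi) !(rmorphXn phi) pa pb pc pd phiC.
by rewrite /smon !exprD !exprMn; ring.
Qed.

Lemma slope_le_segre f : slope_le 0 (phi f).
Proof.
elim/mpolyind: f => [|c m f _ _ IHf] i j.
  by rewrite rmorph0 !coef0 size_poly0.
rewrite rmorphD !coefD segre_mpolyX coef_smon (leq_trans (size_polyD _ _)) //.
rewrite geq_max IHf andbT.
case: andP => [[/eqP-> /eqP->]|_]; last by rewrite size_poly0.
rewrite mulr1n mul_polyC (leq_trans (size_scale_leq _ _)) ?size_polyXn //; lia.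
Qed.

Lemma segre_section_mon i j k : (k <= i + j)%N ->
  phi (section_mon i j k) = vs ^+ i * vr ^+ j * vy ^+ k.
Proof.
have [phiC pa pb pc pd] := phiP.
rewrite /section_mon => le_kij; case: leqP => [le_ki|lt_ik].
  rewrite !(rmorphM phi) !(rmorphXn phi) pa pb pc.
  by rewrite -[in RHS](subnK le_ki) exprMn exprD; ring.
rewrite !(rmorphM phi) !(rmorphXn phi) pb pc pd.
transitivity (vs ^+ i * (vr ^+ (j - (k - i)) * vr ^+ (k - i))
              * (vy ^+ i * vy ^+ (k - i))); first by rewrite !exprMn; ring.
by rewrite -!exprD subnK ?subnKC //; lia.
Qed.

Lemma segre_section_phi f : exists f', segre_section (phi f) = f + vdet K * f'.
Proof.
elim/mpolyind: f => [|c m f _ _ [f' IHf]].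
  exists 0; rewrite rmorph0 mulr0 addr0.
  by rewrite /segre_section /coef_sum size_poly0 big_ord0.
rewrite rmorphD segre_sectionD IHf segre_mpolyX segre_section_smon.
have [g ->] := section_mon_congr (m (@Ordinal 4 0 isT)) (m (@Ordinal 4 1 isT))
  (m (@Ordinal 4 2 isT)) (m (@Ordinal 4 3 isT)).
exists (c%:MP * g + f'); rewrite -mpolyX4E -mul_mpolyC.
by ring.
Qed.

Lemma segre_ker f : phi f = 0 -> exists f', f = vdet K * f'.
Proof.
move=> f0; have [f'] := segre_section_phi f.
rewrite f0 /segre_section /coef_sum size_poly0 big_ord0 => E.
by exists (- f'); rewrite mulrN; apply/eqP; rewrite -addr_eq0 -E.
Qed.
End SegreMap.
End Segre.

(** * Generation of the intersection *)

Section Generation.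
Variable K : idomainType.
Notation R := {mpoly K[4]}.
Notation T := {poly {poly {poly K}}}.
Notation Iab := (ideal_gen [set va; vb : R]).
Notation Icd := (ideal_gen [set vc; vd : R]).
Notation Idiff := (ideal_gen [set va - vc; vb - vd : R]).
Notation Delta := (vdet K).

Lemma idealJ_is_ideal d1 d2 : is_ideal (@idealJ K d1 d2).
Proof.
have [a0 aD aM] := ideal_exp_is_ideal Iab d1.
have [c0 cD cM] := ideal_exp_is_ideal Icd d2.
have [e0 eD eM] := ideal_exp_is_ideal Idiff d1.
split=> [//|x y [[? ?] ?] [[? ?] ?]|r x [[? ?] ?]].
  by split; [split; [apply: aD|apply: cD]|apply: eD].
by split; [split; [apply: aM|apply: cM]|apply: eM].
Qed.

Lemma vdet_mem : [/\ Iab Delta, Icd Delta & Idiff Delta].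
Proof.
have mem2 (x y u v : R) : ideal_gen [set x; y] (u * x + v * y).
  have [_ D M] := ideal_gen_is_ideal [set x; y].
  by apply: D; apply: M; apply: sub_ideal_gen; [left|right].
split.
- by have := mem2 va vb vd (- vc); congr (ideal_gen _ _); rewrite /vdet; ring.
- by have := mem2 vc vd (- vb) va; congr (ideal_gen _ _); rewrite /vdet; ring.
- have := mem2 (va - vc) (vb - vd) vb (- va).
  by congr (ideal_gen _ _); rewrite /vdet; ring.
Qed.

(** The shape of all the generators: since the minor is in each of the three
    ideals, its [j]-th power accounts for [j] factors in each of them. *)
Lemma idealJ_mem d1 d2 j (p q e : R) : (j <= d1)%N -> (j <= d2)%N ->
    ideal_exp Iab (d1 - j) p -> ideal_exp Icd (d2 - j) q ->
    ideal_exp Idiff (d1 - j) e ->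
  idealJ d1 d2 (p * q * e * Delta ^+ j).
Proof.
move=> le1 le2 Ip Iq Ie; have [Da Dc De] := vdet_mem.
have mem I d x z : (j <= d)%N -> I Delta -> ideal_exp I (d - j) x ->
    ideal_exp I d (z * (x * Delta ^+ j)).
  move=> le_jd ID Ix; have [_ _ M] := ideal_exp_is_ideal I d; apply: (M).
  rewrite -[d in ideal_exp _ d](subnK le_jd).
  by apply: ideal_expD => //; apply: ideal_expX.
split; [split|].
- have <- : (q * e) * (p * Delta ^+ j) = p * q * e * Delta ^+ j by ring.
  exact: mem le1 Da Ip.
- have <- : (p * e) * (q * Delta ^+ j) = p * q * e * Delta ^+ j by ring.
  exact: mem le2 Dc Iq.
- have <- : (p * q) * (e * Delta ^+ j) = p * q * e * Delta ^+ j by ring.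
  exact: mem le1 De Ie.
Qed.

Lemma allgens_sub_idealJ d1 d2 : (d1 <= d2)%N ->
  forall f : R, allgens d1 d2 f -> idealJ d1 d2 f.
Proof.
move=> le_d f.
have mem j p q e : (j <= d1)%N ->
    ideal_exp Iab (d1 - j) p -> ideal_exp Icd (d2 - j) q ->
    ideal_exp Idiff (d1 - j) e -> idealJ d1 d2 (p * q * e * Delta ^+ j).
  by move=> le_j1; apply: idealJ_mem => //; apply: leq_trans le_d.
case=> [[[|]|]|] [j /= le_j].
- case=> i /= /andP[_ le_i] <-.
  rewrite /genA -[_ * _ * (va - vc) ^+ _ * _]mulrA.
  by apply: mem => //; last exact: ideal_exp_pair;
    apply: ideal_exp_gen_pow; left.
- case=> i /= /andP[_ le_i] <-; rewrite /genB.
  apply: mem => //; [|by apply: ideal_exp_gen_pow; right..].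
  by have := @ideal_exp_pair R va vb _ _ (leq_subr i (d1 - j)); rewrite subKn.
- case=> i /= /andP[_ le_i] <-; rewrite /genC -[va ^+ _ * _ * _]mulrA.
  apply: mem => //; last by apply: ideal_exp_gen_pow; right.
    by apply: ideal_exp_gen_pow; left.
  exact: ideal_exp_pair.
- move=> ->; apply: mem => //; apply: ideal_exp_gen_pow; by [left|right].
Qed.

Lemma allgens_mul_vdet d1 d2 f :
  allgens d1 d2 f -> allgens d1.+1 d2.+1 (f * Delta).
Proof.
have DX j : Delta ^+ j * Delta = Delta ^+ j.+1 by rewrite exprSr.
case=> [[[|]|]|] [j /= le_j].
- case=> i /= le_i <-; left; left; left.
  exists j.+1 => //; exists i; first by rewrite /= subSS.
  by rewrite /genA !subSS -[RHS]mulrA -DX !mulrA.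
- case=> i /= le_i <-; left; left; right.
  exists j.+1 => //; exists i; first by rewrite /= subSS.
  by rewrite /genB !subSS -DX !mulrA.
- case=> i /= le_i <-; left; right.
  exists j.+1 => //; exists i; first by rewrite /= subSS.
  by rewrite /genC !subSS -DX !mulrA.
- move=> ->; right; exists j.+1 => //.
  by rewrite /rowD /genD !subSS /= -DX !mulrA.
Qed.

Lemma idealJ_colon d1 d2 g : idealJ d1.+1 d2.+1 (Delta * g) -> idealJ d1 d2 g.
Proof.
move=> [[Ia Ic] Ie]; split; last exact: vdet_colon_diff.
by split; [apply: vdet_colon_ab|apply: vdet_colon_cd].
Qed.

Section SegreMap.
Variable phi : {rmorphism R -> T}.
Hypothesis phiP : is_segre phi.

(** The image of [J] is contained in the multiples [S h] of the common factor
    [S] for which [h] has slope at most the degree of [S]: the image [S h] has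
    slope at most [0], and removing a linear factor of [S] raises the bound by
    one. *)
Lemma segre_idealJ d1 d2 f : idealJ d1 d2 f ->
  exists2 h, phi f = common_factor K d1 d2 * h & slope_le (d1 + d1 + d2) h.
Proof.
have [phiC pa pb pc pd] := phiP.
move=> [[Ia Ic] Ie].
have [|u1 h1] := @dvd_ideal_exp _ _ phi _ (vs K) _ _ _ Ia.
  by move=> _ [->|->]; [exists 1; rewrite pa mulr1|exists (vy K); rewrite pb].
have [|u2 h2] := @dvd_ideal_exp _ _ phi _ (vr K) _ _ _ Ic.
  by move=> _ [->|->]; [exists 1; rewrite pc mulr1|exists (vy K); rewrite pd].
have [|u3 h3] := @dvd_ideal_exp _ _ phi _ (vs K - vr K) _ _ _ Ie.
  move=> _ [->|->]; rewrite (rmorphB phi) ?pa ?pb ?pc ?pd.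
    by exists 1; rewrite mulr1.
  by exists (vy K); rewrite mulrBl.
have [h E] := common_factor_dvd h1 h2 h3; exists h => //.
by apply: slope_le_common_factor; rewrite -E; apply: slope_le_segre.
Qed.

(** The families [A], [C], [D], [B] with [j = 0] cover, in this order, the
    increasing values of [n]. *)
Lemma segre_gens d1 d2 n : (n <= d1 + d1 + d2)%N ->
  exists2 f, allgens d1 d2 f & phi f = common_factor K d1 d2 * vy K ^+ n.
Proof.
have [phiC pa pb pc pd] := phiP => le_n.
have [lt_n1|le_1n] := ltnP n d1.
  exists (genA d1 d2 (d1 - n) 0).
    by left; left; left; exists 0%N => //; exists (d1 - n)%N => //=; lia.
  rewrite /genA !subn0 subKn ?(ltnW lt_n1) // expr0 mulr1.
  rewrite !(rmorphM phi) !(rmorphXn phi) !(rmorphB phi) pa pb pc pd.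
  rewrite /common_factor -mulrBl exprMn.
  transitivity (vs K ^+ d1 * vr K ^+ d2
    * ((vs K - vr K) ^+ (d1 - n) * (vs K - vr K) ^+ n) * vy K ^+ n).
    by ring.
  by rewrite -exprD subnK ?(ltnW lt_n1) //; ring.
have phiBD : phi (vb - vd) = (vs K - vr K) * vy K.
  by rewrite (rmorphB phi) pb pd mulrBl.
have [lt_n12|le_12n] := ltnP n (d1 + d2).
  have [k [nE kE]] : exists k, n = (d1 + (d2 - k))%N /\ (0 < k <= d2)%N.
    by exists (d1 + d2 - n)%N; lia.
  exists (genC d1 d2 k 0).
    by left; right; exists 0%N => //; exists k => //=; lia.
  rewrite /genC !subn0 expr0 mulr1 nE.
  rewrite !(rmorphM phi) !(rmorphXn phi) phiBD pa pc pd /common_factor.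
  have le_kd : (k <= d2)%N by lia.
  transitivity (vs K ^+ d1 * (vr K ^+ k * vr K ^+ (d2 - k))
    * (vs K - vr K) ^+ d1 * vy K ^+ (d1 + (d2 - k))).
    by rewrite exprD !exprMn; ring.
  by rewrite -exprD subnKC //; ring.
have [->|ne_n] := eqVneq n (d1 + d2)%N.
  exists (genD d1 d2 0); first by right; exists 0%N.
  rewrite /genD !subn0 expr0 mulr1.
  rewrite !(rmorphM phi) !(rmorphXn phi) phiBD pa pd /common_factor.
  by rewrite !exprD !exprMn; ring.
have [k [nE kE]] : exists k, n = (d1 + d2 + k)%N /\ (0 < k <= d1)%N.
  by exists (n - (d1 + d2))%N; lia.
exists (genB d1 d2 k 0).
  by left; left; right; exists 0%N => //; exists k => //=; lia.
rewrite /genB !subn0 expr0 mulr1 nE.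
rewrite !(rmorphM phi) !(rmorphXn phi) phiBD pa pb pd /common_factor.
have le_kd : (k <= d1)%N by lia.
transitivity ((vs K ^+ k * vs K ^+ (d1 - k)) * vr K ^+ d2
  * (vs K - vr K) ^+ d1 * vy K ^+ (d1 + d2 + k)).
  by rewrite !exprD !exprMn; ring.
by rewrite -exprD subnKC //; ring.
Qed.

Lemma segre_lift d1 d2 h : slope_le (d1 + d1 + d2) h ->
  exists2 f, ideal_gen (allgens d1 d2) f & phi f = common_factor K d1 d2 * h.
Proof.
have [phiC _ _ _ _] := phiP.
have [L0 LD LM] := ideal_gen_is_ideal (@allgens K d1 d2).
elim/slope_le_ind => [|g h' [f Lf fE] [f' Lf' f'E]|c i j k le_k].
- by exists 0 => //; rewrite rmorph0 mulr0.
- by exists (f + f'); [apply: LD|rewrite rmorphD fE f'E mulrDr].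
have [k' [n [kE le_k' le_n]]] : exists k' n,
    [/\ k = (k' + n)%N, (k' <= i + j)%N & (n <= d1 + d1 + d2)%N].
  (* As much of [y^k] as possible goes to the coefficient from [R]. *)
  by exists (minn k (i + j)), (k - (i + j))%N; split; lia.
have [f Lf fE] := segre_gens le_n.
exists (c%:MP * section_mon K i j k' * f).
  by apply: LM; apply: sub_ideal_gen.
rewrite !(rmorphM phi) phiC fE (segre_section_mon phiP) // /smon kE exprD.
by ring.
Qed.
End SegreMap.

(** Induction on [d1]: the generators with [j = 0] span [J] modulo the minor,
    and the remaining multiple of the minor, divided by it, falls in [J] for
    [d1 - 1] and [d2 - 1]. *)
Lemma idealJ_sub_gens d1 d2 (f : R) : (d1 <= d2)%N ->
  idealJ d1 d2 f -> ideal_gen (allgens d1 d2) f.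
Proof.
elim: d1 d2 f => [|d1 IHd] d2 f le_d Jf.
  have [[_ Ic] _] := Jf.
  apply: (ideal_exp_pair_ind (ideal_gen_is_ideal _)) Ic => i le_i.
  apply: sub_ideal_gen; case: i le_i => [_|i le_i].
    by right; exists 0%N => //; rewrite /rowD /genD !subn0 !expr0 !mul1r !mulr1.
  left; right; exists 0%N => //; exists i.+1; first by rewrite /= subn0.
  by rewrite /genC !subn0 !expr0 !mul1r !mulr1.
have [phi phiP] := is_segre_exists K.
have [h fE h_le] := segre_idealJ phiP Jf.
have [f' Lf' f'E] := segre_lift phiP h_le.
have [g gE] : exists g, f - f' = Delta * g.
  by apply: (segre_ker phiP); rewrite rmorphB fE f'E subrr.
have [J0 JD JM] := idealJ_is_ideal d1.+1 d2.
have [L0 LD LM] := ideal_gen_is_ideal (@allgens K d1.+1 d2).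
have Jf' := ideal_gen_ind (idealJ_is_ideal _ _) (allgens_sub_idealJ le_d) Lf'.
have Jg : idealJ d1.+1 d2 (Delta * g).
  by rewrite -gE; apply: JD => //; rewrite -mulN1r; apply: JM.
suff Lg : ideal_gen (allgens d1.+1 d2) (g * Delta).
  by rewrite -(subrK f' f) gE mulrC; apply: LD.
move: le_d Jg; clear -IHd; case: d2 => // d2 le_d Jg.
have gens_Delta x : allgens d1 d2 x ->
    ideal_gen (allgens d1.+1 d2.+1) (x * Delta).
  by move=> Lx; apply: sub_ideal_gen; apply: allgens_mul_vdet.
apply: (ideal_gen_ind (is_ideal_colon Delta (ideal_gen_is_ideal _)) gens_Delta).
exact: IHd (idealJ_colon Jg).
Qed.

Lemma idealJ_gens d1 d2 : (d1 <= d2)%N ->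
  idealJ d1 d2 = ideal_gen (allgens d1 d2) :> set R.
Proof.
move=> le_d; apply/seteqP; split=> f; first exact: idealJ_sub_gens.
exact: (ideal_gen_ind (idealJ_is_ideal _ _) (allgens_sub_idealJ le_d)).
Qed.
End Generation.

(** * Bidegrees *)

Section Bidegree.
Variable K : idomainType.
Notation R := {mpoly K[4]}.
Notation Delta := (vdet K).
Implicit Types (p q g : R).

Lemma has_bidegreeM p q m n m' n' : has_bidegree p m n ->
  has_bidegree q m' n' -> has_bidegree (p * q) (m + m') (n + n').
Proof.
move=> [p0 pm pn] [q0 qm qn]; split; first exact: mulf_neq0.
  exact: dhomogM.
exact: dhomogM.
Qed.

Lemma has_bidegreeX p m n k :
  has_bidegree p m n -> has_bidegree (p ^+ k) (m * k) (n * k).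
Proof.
by move=> [p0 pm pn]; split; [exact: expf_neq0|exact: dhomogMn|exact: dhomogMn].
Qed.

Lemma has_bidegree_uniq p m n m' n' :
  has_bidegree p m n -> has_bidegree p m' n' -> m = m' /\ n = n'.
Proof.
by move=> [p0 pm pn] [_ pm' pn']; split; apply: dhomog_uniq; eassumption.
Qed.

(** The four variables have bidegrees [q, t, q, t]. *)
Lemma has_bidegree_var (i : 'I_4) :
  has_bidegree ('X_i : R) (~~ odd i) (odd i).
Proof.
split; first by rewrite -msupp_eq0 msuppX.
all: rewrite dhomogX /=.
all: rewrite /degq /degt !mnm1E.
all: by case: i => [[|[|[|[|]]]]].
Qed.

Lemma has_bidegree_sub (i j : 'I_4) : i != j -> odd i = odd j ->
  has_bidegree ('X_i - 'X_j : R) (~~ odd i) (odd i).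
Proof.
move=> ne_ij oij; have [_ iq it] := has_bidegree_var i.
have [_ jq jt] := has_bidegree_var j; rewrite -oij in jq jt.
split; [|exact: rpredB|exact: rpredB].
apply/eqP => /(congr1 (mcoeff U_(i))) /eqP.
rewrite mcoeffB !mcoeffXU eqxx (eq_sym j) (negbTE ne_ij) subr0 mcoeff0.
by rewrite oner_eq0.
Qed.

Let bia : has_bidegree (va : R) 1 0 := has_bidegree_var (@Ordinal 4 0 isT).
Let bib : has_bidegree (vb : R) 0 1 := has_bidegree_var (@Ordinal 4 1 isT).
Let bic : has_bidegree (vc : R) 1 0 := has_bidegree_var (@Ordinal 4 2 isT).
Let bid : has_bidegree (vd : R) 0 1 := has_bidegree_var (@Ordinal 4 3 isT).
Let biac : has_bidegree (va - vc : R) 1 0 :=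
  @has_bidegree_sub (@Ordinal 4 0 isT) (@Ordinal 4 2 isT) isT erefl.
Let bibd : has_bidegree (vb - vd : R) 0 1 :=
  @has_bidegree_sub (@Ordinal 4 1 isT) (@Ordinal 4 3 isT) isT erefl.

Lemma has_bidegree_vdet : has_bidegree Delta 1 1.
Proof.
have [_ adq adt] := has_bidegreeM bia bid.
have [_ bcq bct] := has_bidegreeM bib bic.
by split; [exact: vdet_neq0|exact: rpredB|exact: rpredB].
Qed.

(** Members of a family are told apart by their degree. *)
Lemma card_family (f : nat -> R) (n : nat) (mu nu : nat -> nat) :
    (forall i, (1 <= i <= n)%N -> has_bidegree (f i) (mu i) (nu i)) ->
    {in [set i | (1 <= i <= n)%N] &, injective mu} ->
  [set f i | i in [set i | (1 <= i <= n)%N]] #= `I_n.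
Proof.
move=> fP mu_inj.
have -> : [set f i | i in [set i | (1 <= i <= n)%N]] = (f \o succn) @` `I_n.
  apply/seteqP; split=> _ [i /= le_i <-].
    by exists i.-1; rewrite /= ?prednK //; lia.
  by exists i.+1.
apply: inj_card_eq => i j /set_mem /= lt_i /set_mem /= lt_j E.
have := fP j.+1 lt_j; rewrite -E => /(has_bidegree_uniq (fP i.+1 lt_i))[].
by move=> /mu_inj; rewrite !inE => /(_ lt_i lt_j) [].
Qed.

Variables d1 d2 : nat.
Hypothesis le_d : (d1 <= d2)%N.

Let has_bidegree_prod p1 p2 p3 p4 m1 m2 m3 m4 n1 n2 n3 n4 k1 k2 k3 k4 j m n :
  has_bidegree p1 m1 n1 -> has_bidegree p2 m2 n2 ->
  has_bidegree p3 m3 n3 -> has_bidegree p4 m4 n4 ->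
  (m = m1 * k1 + m2 * k2 + m3 * k3 + m4 * k4 + j)%N ->
  (n = n1 * k1 + n2 * k2 + n3 * k3 + n4 * k4 + j)%N ->
  has_bidegree (p1 ^+ k1 * p2 ^+ k2 * p3 ^+ k3 * p4 ^+ k4 * Delta ^+ j) m n.
Proof.
move=> h1 h2 h3 h4 -> ->.
have := has_bidegreeX j has_bidegree_vdet; rewrite mul1n.
apply: has_bidegreeM; have XM := has_bidegreeX.
exact: has_bidegreeM (has_bidegreeM (has_bidegreeM (XM _ _ _ k1 h1)
  (XM _ _ _ k2 h2)) (XM _ _ _ k3 h3)) (XM _ _ _ k4 h4).
Qed.

Lemma has_bidegree_genA i j : (j <= d1)%N -> (1 <= i <= d1 - j)%N ->
  has_bidegree (genA d1 d2 i j : R) (d1 + d2 - j + i) (d1 - i).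
Proof.
by move=> le_j le_i; apply: (has_bidegree_prod bia bic biac bibd) => /=; lia.
Qed.

Lemma has_bidegree_genB i j : (j <= d1)%N -> (1 <= i <= d1 - j)%N ->
  has_bidegree (genB d1 d2 i j : R) (d1 - i) (d1 + d2 - j + i).
Proof.
by move=> le_j le_i; apply: (has_bidegree_prod bia bib bid bibd) => /=; lia.
Qed.

Lemma has_bidegree_genC i j : (j <= d1)%N -> (1 <= i <= d2 - j)%N ->
  has_bidegree (genC d1 d2 i j : R) (d1 + i) (d1 + d2 - j - i).
Proof.
by move=> le_j le_i; apply: (has_bidegree_prod bia bic bid bibd) => /=; lia.
Qed.

Lemma has_bidegree_genD j : (j <= d1)%N ->
  has_bidegree (genD d1 d2 j : R) d1 (d1 + d2 - j).
Proof.
move=> le_j; have := has_bidegree_prod (k2 := 0) (j := j) bia bia bid bibd.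
move=> /(_ (d1 - j)%N (d2 - j)%N (d1 - j)%N).
by rewrite expr0 mulr1; apply => /=; lia.
Qed.

(** The conditions on degrees are incompatible, so each family is characterized
    by its own. *)
Lemma separated_by_degrees (PA PB PC PD : Prop) m n :
    (PA -> (d1 < m)%N /\ (n < d1)%N) -> (PB -> (m < d1)%N /\ (d1 <= n)%N) ->
    (PC -> (d1 < m)%N /\ (d1 <= n)%N) -> (PD -> m = d1 /\ (d1 <= n)%N) ->
    ((PA \/ PB) \/ PC) \/ PD ->
  [/\ PA <-> (n < d1)%N, PB <-> (m < d1)%N,
      PC <-> (d1 < m)%N /\ (d1 <= n)%N & PD <-> m = d1].
Proof.
move=> hA hB hC hD [[[/[dup] ? /hA|/[dup] ? /hB]|/[dup] ? /hC]|/[dup] ? /hD];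
  case=> ? ?; split; split=> //; by [move=> /hA; lia | move=> /hB; lia
  | move=> /hC; lia | move=> /hD; lia | lia].
Qed.

Lemma family_bounds g m n : has_bidegree g m n ->
  [/\ famA d1 d2 g -> (d1 < m)%N /\ (n < d1)%N,
      famB d1 d2 g -> (m < d1)%N /\ (d1 <= n)%N,
      famC d1 d2 g -> (d1 < m)%N /\ (d1 <= n)%N &
      famD d1 d2 g -> m = d1 /\ (d1 <= n)%N].
Proof.
move=> gP; split; move=> [j /= le_j].
- case=> i /= le_i E; rewrite -E in gP.
  by have [-> ->] := has_bidegree_uniq gP (has_bidegree_genA le_j le_i); lia.
- case=> i /= le_i E; rewrite -E in gP.
  by have [-> ->] := has_bidegree_uniq gP (has_bidegree_genB le_j le_i); lia.
- case=> i /= le_i E; rewrite -E in gP.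
  by have [-> ->] := has_bidegree_uniq gP (has_bidegree_genC le_j le_i); lia.
- move=> /= E; rewrite E in gP.
  by have [-> ->] := has_bidegree_uniq gP (has_bidegree_genD le_j); lia.
Qed.

Lemma family_degrees g m n : allgens d1 d2 g -> has_bidegree g m n ->
  [/\ famA d1 d2 g <-> (n < d1)%N, famB d1 d2 g <-> (m < d1)%N,
      famC d1 d2 g <-> (d1 < m)%N /\ (d1 <= n)%N & famD d1 d2 g <-> m = d1].
Proof.
move=> gG /family_bounds[hA hB hC hD].
exact: (separated_by_degrees hA hB hC hD gG).
Qed.
End Bidegree.

Theorem theorem4p1 (R : realType) (d1 d2 : nat) (hd : (d1 <= d2)%N) :
  [/\ idealJ d1 d2 = ideal_gen (allgens d1 d2) :> set {mpoly R[i][4]},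
      [/\ forall i j : nat, (j <= d1)%N -> (1 <= i <= d1 - j)%N ->
            has_bidegree (genA d1 d2 i j : {mpoly R[i][4]})
              (d1 + d2 - j + i) (d1 - i),
          forall j : nat, (j <= d1)%N ->
            (rowA d1 d2 j : set {mpoly R[i][4]}) #= `I_(d1 - j) &
          forall (g : {mpoly R[i][4]}) (m n : nat),
            allgens d1 d2 g -> has_bidegree g m n ->
            (famA d1 d2 g <-> (n < d1)%N)],
      [/\ forall i j : nat, (j <= d1)%N -> (1 <= i <= d1 - j)%N ->
            has_bidegree (genB d1 d2 i j : {mpoly R[i][4]})
              (d1 - i) (d1 + d2 - j + i),
          forall j : nat, (j <= d1)%N ->
            (rowB d1 d2 j : set {mpoly R[i][4]}) #= `I_(d1 - j) &
          forall (g : {mpoly R[i][4]}) (m n : nat),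
            allgens d1 d2 g -> has_bidegree g m n ->
            (famB d1 d2 g <-> (m < d1)%N)],
      [/\ forall i j : nat, (j <= d1)%N -> (1 <= i <= d2 - j)%N ->
            has_bidegree (genC d1 d2 i j : {mpoly R[i][4]})
              (d1 + i) (d1 + d2 - j - i),
          forall j : nat, (j <= d1)%N ->
            (rowC d1 d2 j : set {mpoly R[i][4]}) #= `I_(d2 - j) &
          forall (g : {mpoly R[i][4]}) (m n : nat),
            allgens d1 d2 g -> has_bidegree g m n ->
            (famC d1 d2 g <-> (d1 < m)%N /\ (d1 <= n)%N)] &
      [/\ forall j : nat, (j <= d1)%N ->
            has_bidegree (genD d1 d2 j : {mpoly R[i][4]}) d1 (d1 + d2 - j),
          forall j : nat, (j <= d1)%N ->
            (rowD d1 d2 j : set {mpoly R[i][4]}) #= `I_1 &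
          forall (g : {mpoly R[i][4]}) (m n : nat),
            allgens d1 d2 g -> has_bidegree g m n ->
            (famD d1 d2 g <-> m = d1)]].
Proof.
split; first exact: idealJ_gens.
- split=> [i j le_j le_i|j le_j|g m n gG gP].
  + exact: has_bidegree_genA.
  + apply: (card_family (mu := (fun i => d1 + d2 - j + i)%N)
                        (nu := (fun i => d1 - i)%N)).
      by move=> i; apply: has_bidegree_genA.
    by move=> i k _ _ /=; lia.
  + by have [] := family_degrees hd gG gP.
- split=> [i j le_j le_i|j le_j|g m n gG gP].
  + exact: has_bidegree_genB.
  + apply: (card_family (mu := (fun i => d1 - i)%N)
                        (nu := (fun i => d1 + d2 - j + i)%N)).
      by move=> i; apply: has_bidegree_genB.
    by move=> i k /set_mem /= le_i /set_mem /= le_k; lia.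
  + by have [] := family_degrees hd gG gP.
- split=> [i j le_j le_i|j le_j|g m n gG gP].
  + exact: has_bidegree_genC.
  + apply: (card_family (mu := (fun i => d1 + i)%N)
                        (nu := (fun i => d1 + d2 - j - i)%N)).
      by move=> i; apply: has_bidegree_genC.
    by move=> i k _ _ /=; lia.
  + by have [] := family_degrees hd gG gP.
- split=> [j le_j|j le_j|g m n gG gP].
  + exact: has_bidegree_genD.
  + exact: card_set1.
  + by have [] := family_degrees hd gG gP.
Qed.
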